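(* Let $\Omega$ be a finite totally ordered set, let $G\le \operatorname{Sym}(\Omega)$, and let $X$ be a set of objects on which $\operatorname{Sym}(\Omega)$ (and hence $G$) acts, with a total ordering $\preccurlyeq$ on $X$. Fix a set of compatible refiners for the elements of $X$ (for each $a\in X$, a refiner $R_a$ for $a$ that is compatible with $\operatorname{Sym}(\Omega)$), a refiner $R_G$ for $G$, an ordered orbit estimator $\mathrm{Part}$ with corresponding approximator $\mathrm{Approx}$, a compatible splitter $\mathrm{Split}$ with respect to $\mathrm{Approx}$, and a compatible partial order $\preceq$ on the set of labelled digraph stacks on $\Omega$. Let $\mathrm{Canonical}$ be the assignment defined in the context, which sends $a\in X$ to $\min_{\preccurlyeq}\{a^g\mid g\in P_a\}$. Then $\mathrm{Canonical}$ is a well-defined function from $X$ to itself, and moreover it is a canonical labelling function with respect to the action of $G$ on $X$; that is, for all $a\in X$, $\mathrm{Canonical}(a)\in a^G$, and $\mathrm{Canonical}(a^g)=\mathrm{Canonical}(a)$ for all $g\in G$.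
   Context: All actions are right actions, written exponentially. **Labelled digraph stacks.** Fix a label set $\mathfrak L$. A labelled digraph on $\Omega$ is a triple $(\Omega,A,\lambda)$ with $A\subseteq\Omega\times\Omega$ and $\lambda:\Omega\cup A\to\mathfrak L$. $\operatorname{Sym}(\Omega)$ acts on labelled digraphs by renaming vertices (labels are carried along). A labelled digraph stack on $\Omega$ is a finite, possibly empty, list of labelled digraphs on $\Omega$; $\operatorname{Sym}(\Omega)$ acts entrywise on stacks. Let $\mathcal S$ be the set of all such stacks. $|S|$ is the length of $S$, and $S\Vert T$ denotes the stack obtained by appending $T$ to $S$. $\operatorname{Iso}(S,T)$ is the set of $g\in\operatorname{Sym}(\Omega)$ with $S^g=T$ (empty if the lengths differ), $\operatorname{Aut}(S)=\operatorname{Iso}(S,S)$, and $S\cong T$ means $\operatorname{Iso}(S,T)\neq\varnothing$. **Refiners.** A refiner for $a\in X$ is a function $R:\mathcal S\to\mathcal S$ such that whenever $S,T\in\mathcal S$ and $S\cong T$, $\operatorname{Sym}(\Omega)_a\cap\operatorname{Iso}(S,T)\subseteq\operatorname{Sym}(\Omega)_a\cap\operatorname{Iso}(R(S),R(T))$, where $\operatorname{Sym}(\Omega)_a$ is the stabiliser of $a$. A refiner $R$ for $a$ is compatible with $\operatorname{Sym}(\Omega)$ if and only if $R(S^g)=(R(S))^g$ for all $S\in\mathcal S$ and all $g\in\operatorname{Sym}(\Omega)$. A refiner for $G$ is a function $R_G:\mathcal S\to\mathcal S$ such that whenever $S\cong T$, $G\cap\operatorname{Iso}(S,T)\subseteq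 G\cap\operatorname{Iso}(R_G(S),R_G(T))$ (it need not be compatible with $\operatorname{Sym}(\Omega)$). **Ordered orbit estimator and approximator.** An ordered orbit estimator is a function $\mathrm{Part}$ from $\mathcal S$ to the set of ordered partitions of $\Omega$ (lists of disjoint nonempty unordered cells with union $\Omega$) such that for each $S\in\mathcal S$: if $i,j\in\Omega$ are in the same orbit of $\operatorname{Aut}(S)$, then they are in the same cell of $\mathrm{Part}(S)$; and $\mathrm{Part}(S)^g=\mathrm{Part}(S^g)$ for all $g\in\operatorname{Sym}(\Omega)$. The corresponding approximator $\mathrm{Approx}(S,T)$ is the set of permutations in $\operatorname{Sym}(\Omega)$ that map $\mathrm{Part}(S)$ to $\mathrm{Part}(T)$; write $\mathrm{Approx}(S)=\mathrm{Approx}(S,S)$. For an ordered partition $P$, $\mathrm{Fix}(P)$ is the list of elements of $\Omega$ lying in singleton cells of $P$, in the order in which they appear in $P$. **Compatible isomorphism approximator.** This is a function $\mathrm{Approx}$ mapping each pair of stacks to a subgroup of $\operatorname{Sym}(\Omega)$, a coset of a subgroup of $\operatorname{Sym}(\Omega)$, or the empty set, such that for all $S,T\in\mathcal S$ and $g\in\operatorname{Sym}(\Omega)$: (i) $\operatorname{Iso}(S,T)\subseteq\mathrm{Approx}(S,T)$; (ii) if $|S|\ne|T|$, then $\mathrm{Approx}(S,T)=\varnothing$; (iii) if $\mathrm{Approx}(S,T)\neq\varnothing$, then $\mathrm{Approx}(S,T)=\mathrm{Approx}(S,S)\cdot h$ for some $h\in\operatorname{Sym}(\Omega)$; (iv)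 $\mathrm{Approx}(S^g,T^g)=\mathrm{Approx}(S,T)^g$. **Compatible splitter.** Suppose that $\mathrm{Approx}$ is a compatible isomorphism approximator. A function $\mathrm{Split}$ from $\{T\in\mathcal S : |\mathrm{Approx}(T)|>1\}$ to the set of finite ordered lists of stacks is a compatible splitter with respect to $\mathrm{Approx}$ if and only if for every such $T$, with $\mathrm{Split}(T)=[T_1,\dots,T_n]$: (i) $\operatorname{Iso}(T,T)=\operatorname{Iso}(T\Vert T_1,T\Vert T_1)\cup\operatorname{Iso}(T\Vert T_1,T\Vert T_2)\cup\dots\cup\operatorname{Iso}(T\Vert T_1,T\Vert T_n)$; (ii) $|\mathrm{Approx}(T\Vert T_1,T\Vert T_i)|<|\mathrm{Approx}(T)|$ for all $i\in\{1,\dots,n\}$; (iii) for all $g\in\operatorname{Sym}(\Omega)$, the lists $\mathrm{Split}(T^g)$ and $(\mathrm{Split}(T))^g=[T_1^g,\dots,T_n^g]$ are equal up to ordering. **Compatible partial order.** A compatible partial order on $\mathcal S$ is a partial order $\preceq$ on $\mathcal S$ such that for all $S,T\in\mathcal S$ and all $g_1,g_2\in\operatorname{Sym}(\Omega)$: $S\preceq T$ if and only if $S^{g_1}\preceq T^{g_2}$. **Minimising permutation.** Given a list $L$ of elements of $\Omega$, $\mathrm{MinPerm}(G,L)$ is a permutation in $G$ that maps $L$ point-wise to its lexicographically minimal image under $G$; if $L$ contains each element of $\Omega$ exactly once, this permutation is unique. **Search tree $T_a$ for $a\in X$.** The procedure $\mathrm{Refine}$ on a stack $S$ repeats the following: save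 $S_C:=S$; replace $S$ by $S\Vert R_a(S)$; then replace $S$ by $S\Vert R_G(S)$; if $|\mathrm{Approx}(S)|\not<|\mathrm{Approx}(S_C)|$, stop and return $S$. The recursive procedure $\mathrm{Search}(S)$ computes $S':=\mathrm{Refine}(S)$. If $|\mathrm{Approx}(S')|=1$, it returns $\mathrm{MinPerm}(G,\mathrm{Fix}(\mathrm{Part}(S')))$. Otherwise it computes $[S_1,\dots,S_t]=\mathrm{Split}(S')$ and returns the union of the results of $\mathrm{Search}(S'\Vert S_i)$ for $i=1,\dots,t$. The execution, started with $\mathrm{Search}$ of the empty stack, is viewed as a search tree $T_a$, where a search tree is a finite connected directed graph without (directed or undirected) cycles that has a unique root node with no incoming arcs, every other node having exactly one incoming arc. There is one node for each call $\mathrm{Search}(S)$, labelled with the stack $S$, with arcs to the nodes of the recursive calls it makes (children are regarded as unordered). Leaves (nodes without outgoing arcs) are additionally labelled with a result permutation $\mathrm{result}(\cdot)$, the permutation returned by that call. **The assignment $\mathrm{Canonical}$.** For $a\in X$: (1) let $L_a$ be the set of leaves of $T_a$; (2) for each $l\in L_a$, let $\mathrm{Stacks}(l)$ be the list of stack labels, in order, of the nodes on the path from the root of $T_a$ to $l$; (3) extend $\preceq$ to the elements of $\{\mathrm{Stacks}(l)\mid l\in L_a\}$ by ordering these lists lexicographically, comparing pairs of elements by $\preceq$, and let $\prec$ denote ''strictly precedes'' in this extended order; (4) let $M_a=\{m\in L_a\mid\text{there is no }l\in L_a\text{ such that }\mathrm{Stacks}(l)\prec\mathrm{Stacks}(m)\}$;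 (5) let $P_a=\{\mathrm{result}(m)\mid m\in M_a\}$; (6) define $\mathrm{Canonical}(a)=\min_{\preccurlyeq}\{a^g\mid g\in P_a\}$.
   Formalization: Search is assumed to terminate for every a (T_a finite), which the splitter axioms do not imply; Approx(S,T) is set empty when |S|≠|T|; antisymmetry of the stack order holds only up to isomorphism; label equality and the orders are taken decidable. *)

(* Defs.v *)
From Stdlib Require List.
From mathcomp Require Import all_boot all_order all_fingroup.

Set Implicit Arguments.
Unset Strict Implicit.
Unset Printing Implicit Defensive.

Import GroupScope.

Section Stacks.

Variables (Omega : finType) (L : eqType).

(* A labelled digraph (Omega, A, lambda) is a pair (f, h): f is the restriction
   of lambda to Omega; h e = Some l when e is an arc with label l, and
   h e = None when e is not an arc. *)
Definition ldigraph : Type :=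
  ({ffun Omega -> L} * {ffun Omega * Omega -> option L})%type.

(* The arcs of D^g are the pairs (x^g, y^g) with (x, y) an arc of D, and the
   label of x^g (of (x^g, y^g)) in D^g is that of x (of (x, y)) in D. *)
Definition ldigraph_act (D : ldigraph) (g : {perm Omega}) : ldigraph :=
  ([ffun x => D.1 (g^-1 x)], [ffun e => D.2 (g^-1 e.1, g^-1 e.2)]).

Definition stack : Type := seq ldigraph.

Definition stack_act (S : stack) (g : {perm Omega}) : stack :=
  [seq ldigraph_act D g | D <- S].

Definition Iso (S T : stack) : {set {perm Omega}} :=
  [set g | stack_act S g == T].

Definition stack_iso (S T : stack) : bool := Iso S T != set0.

(* The library stabiliser 'C[a | to] would force the type X of objects to be
   finite. *)
Definition obj_stab (X : eqType) (to : {action {perm Omega} &-> X}) (a : X) :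
  {set {perm Omega}} := [set g | to a g == a].

Definition is_refiner_for (H : {set {perm Omega}}) (R : stack -> stack) : Prop :=
  forall S T, stack_iso S T ->
    H :&: Iso S T \subset H :&: Iso (R S) (R T).

Definition is_obj_refiner (X : eqType) (to : {action {perm Omega} &-> X})
    (a : X) (R : stack -> stack) : Prop :=
  is_refiner_for (obj_stab to a) R.

Definition refiner_compatible (R : stack -> stack) : Prop :=
  forall S g, R (stack_act S g) = stack_act (R S) g.

Definition is_ordered_partition (P : seq {set Omega}) : bool :=
  uniq P && partition [set B in P] [set: Omega].

Definition opart_act (P : seq {set Omega}) (g : {perm Omega}) :
  seq {set Omega} := [seq g @: B | B : {set Omega} <- P].

Definition is_ordered_orbit_estimator (Part : stack -> seq {set Omega}) : Prop :=
  [/\ forall S, is_ordered_partition (Part S),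
      forall S i j, j \in orbit 'P (Iso S S) i ->
        exists2 B, B \in Part S & (i \in B) && (j \in B)
    & forall S g, opart_act (Part S) g = Part (stack_act S g)].

(* Stacks of different lengths get the empty set, as clause (ii) of a
   compatible isomorphism approximator demands. This cannot be left to Part
   alone: Omega has finitely many ordered partitions, so Part S and Part T
   coincide for some S and T of different lengths. *)
Definition approx (Part : stack -> seq {set Omega}) (S T : stack) :
    {set {perm Omega}} :=
  [set g | (size S == size T) && (opart_act (Part S) g == Part T)].

Definition is_compatible_approx (A : stack -> stack -> {set {perm Omega}}) :
    Prop :=
  (forall S T, A S T = set0 \/
     exists (H : {group {perm Omega}}) (h : {perm Omega}), A S T = H :* h) /\
  [/\ forall S T, Iso S T \subset A S T,
      forall S T, size S <> size T -> A S T = set0,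
      forall S T, A S T <> set0 -> exists h, A S T = A S S :* h
    & forall S T g, A (stack_act S g) (stack_act T g) = A S T :^ g].

(* Split is a total function here, but only its values on the stacks T with
   |A(T)| > 1 are constrained and used. Clause (i) of the definition forces
   Split T to be nonempty, so the default value of head is irrelevant. *)
Definition is_compatible_splitter (A : stack -> stack -> {set {perm Omega}})
    (Split : stack -> seq stack) : Prop :=
  is_compatible_approx A /\
  forall T, (1 < #|A T T|)%N ->
    let T1 := head [::] (Split T) in
    [/\ Iso T T = \bigcup_(Ti <- Split T) Iso (T ++ T1) (T ++ Ti),
        forall Ti, Ti \in Split T -> (#|A (T ++ T1) (T ++ Ti)| < #|A T T|)%N
      & forall g, perm_eq (Split (stack_act T g))
                          [seq stack_act Ti g | Ti <- Split T]].

(* The compatibility clause gives S <= S^g <= S for all S and g, so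
   antisymmetry can only be asked up to isomorphism of stacks: <= is a partial
   order on isomorphism classes. *)
Definition is_compatible_order (le : rel stack) : Prop :=
  [/\ reflexive le, transitive le,
      forall S T, le S T -> le T S -> stack_iso S T
    & forall S T g1 g2, le S T = le (stack_act S g1) (stack_act T g2)].

Fixpoint lex_le (le : rel stack) (s t : seq stack) : bool :=
  match s, t with
  | [::], _ => true
  | _ :: _, [::] => false
  | x :: s', y :: t' => le x y && (le y x ==> lex_le le s' t')
  end.

Definition lex_lt (le : rel stack) (s t : seq stack) : bool :=
  lex_le le s t && ~~ lex_le le t s.

End Stacks.

Section ApproxCompatible.

Variables (Omega : finType) (L : eqType).
Variable Part : stack Omega L -> seq {set Omega}.

Lemma opart_act1 (P : seq {set Omega}) : opart_act P 1 = P.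
Proof.
rewrite /opart_act -[RHS]map_id; apply: eq_map => B.
by rewrite -[RHS]imset_id; apply: eq_imset => x; rewrite perm1.
Qed.

Lemma opart_actM (P : seq {set Omega}) g h :
  opart_act P (g * h) = opart_act (opart_act P g) h.
Proof.
rewrite /opart_act -map_comp; apply: eq_map => B /=.
by rewrite -imset_comp; apply: eq_imset => x /=; rewrite permM.
Qed.

(* The supposition on approximators in is_compatible_splitter is automatic for
   the approximator of an ordered orbit estimator. *)
Lemma approx_compatible :
  is_ordered_orbit_estimator Part -> is_compatible_approx (approx Part).
Proof.
move=> [_ _ actE].
have actV (P Q : seq {set Omega}) g : (opart_act P g == Q) = (P == opart_act Q g^-1).
  apply/eqP/eqP => [<-|->].
    by rewrite -opart_actM mulgV opart_act1.
  by rewrite -opart_actM mulVg opart_act1.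
have cosetP S T h : h \in approx Part S T ->
    approx Part S T = approx Part S S :* h.
  rewrite inE => /andP[sST /eqP PST]; apply/setP => g.
  rewrite mem_rcoset !inE sST eqxx /= opart_actM -PST.
  by rewrite [in RHS]actV invgK.
have grpS S : group_set (approx Part S S).
  apply/group_setP; split=> [|g h]; rewrite !inE !eqxx /= ?opart_act1 //.
  by move=> /eqP gS /eqP hS; rewrite opart_actM gS hS.
split=> [S T|].
  have [->|/set0Pn[h /cosetP ->]] := eqVneq (approx Part S T) set0.
    by left.
  by right; exists (Group (grpS S)), h.
split=> [S T|S T neST|S T /eqP/set0Pn[h hP]|S T g].
- apply/subsetP => g; rewrite !inE => /eqP <-.
  by rewrite size_map eqxx actE /=.
- by apply/setP => g; rewrite !inE; case: eqP => // /neST.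
- by exists h; apply: cosetP.
- apply/setP => h; rewrite mem_conjg !inE !size_map -!actE.
  by rewrite conjgE invgK !opart_actM [in RHS]actV invgK.
Qed.

End ApproxCompatible.

Section Search.

Variables (d : Order.disp_t) (Omega : finOrderType d) (L : eqType).
Variables (G : {group {perm Omega}}).

(* Lists are compared lexicographically, for the order of Omega. *)
Definition is_min_perm (l : seq Omega) (p : {perm Omega}) : Prop :=
  p \in G /\
  forall h, h \in G ->
    (([seq p x | x <- l] : seqlexi Omega) <= [seq h x | x <- l])%O.

Definition Fix (P : seq {set Omega}) : seq Omega :=
  flatten [seq enum B | B : {set Omega} <- P & #|B| == 1%N].

Variables (RG Ra : stack Omega L -> stack Omega L).
Variables (Part : stack Omega L -> seq {set Omega}).
Variables (Split : stack Omega L -> seq (stack Omega L)).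

Definition refine_step (S : stack Omega L) : stack Omega L :=
  let S1 := S ++ Ra S in S1 ++ RG S1.

(* refines S S' means that Refine, applied to S, stops and returns S'. *)
Inductive refines (S : stack Omega L) : stack Omega L -> Prop :=
| RefineStop of
    ~~ (#|approx Part (refine_step S) (refine_step S)| < #|approx Part S S|)%N :
    refines S (refine_step S)
| RefineLoop S' of
    (#|approx Part (refine_step S) (refine_step S)| < #|approx Part S S|)%N
    & refines (refine_step S) S' : refines S S'.

(* calls S V means that Search(S) makes the recursive call Search(V). *)
Definition calls (S V : stack Omega L) : Prop :=
  exists S', [/\ refines S S', #|approx Part S' S'| <> 1%N
                & exists2 Si, Si \in Split S' & V = S' ++ Si].

(* There is no infinite chain of recursive calls from Search([::]). As every
   call makes finitely many calls, this says that the search tree is finite.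
   It does not follow from is_compatible_splitter: clause (ii) there does not
   bound |A(T ++ Ti)| when A(T ++ T1, T ++ Ti) is empty. *)
Definition search_finite : Prop := Acc (fun V S => calls S V) [::].

(* Every node carries its stack label, leaves also the result permutation. *)
Inductive search_tree : Type :=
| Leaf of stack Omega L & {perm Omega}
| Node of stack Omega L & seq search_tree.

Inductive is_search_tree : stack Omega L -> search_tree -> Prop :=
| SearchLeaf S S' p of
    refines S S' & #|approx Part S' S'| = 1%N & is_min_perm (Fix (Part S')) p :
    is_search_tree S (Leaf S p)
| SearchNode S S' ts of
    refines S S' & #|approx Part S' S'| <> 1%N
    & List.Forall2 (fun Si t => is_search_tree (S' ++ Si) t) (Split S') ts :
    is_search_tree S (Node S ts).

(* The pairs (Stacks(l), result(l)), for l ranging over the leaves of t. *)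
Fixpoint leaves (t : search_tree) : seq (seq (stack Omega L) * {perm Omega}) :=
  match t with
  | Leaf U p => [:: ([:: U], p)]
  | Node U ts =>
      [seq (U :: l.1, l.2) | l <- flatten [seq leaves t' | t' <- ts]]
  end.

Variable le : rel (stack Omega L).

Definition min_leaves (t : search_tree) :
    seq (seq (stack Omega L) * {perm Omega}) :=
  [seq m <- leaves t | ~~ has (fun l => lex_lt le l.1 m.1) (leaves t)].

Definition results (t : search_tree) : seq {perm Omega} :=
  [seq m.2 | m <- min_leaves t].

End Search.

Section Canonical.

Variables (d dX : Order.disp_t) (Omega : finOrderType d) (L : eqType).
Variables (G : {group {perm Omega}}) (X : orderType dX).
Variable to : {action {perm Omega} &-> X}.
Variable R : X -> stack Omega L -> stack Omega L.
Variables (RG : stack Omega L -> stack Omega L).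
Variables (Part : stack Omega L -> seq {set Omega}).
Variables (Split : stack Omega L -> seq (stack Omega L)).
Variable le : rel (stack Omega L).

(* The assignment is a relation: its being the graph of a function (existence
   and uniqueness of c) is part of what is to be proved. *)
Definition is_Canonical (a c : X) : Prop :=
  exists2 t, is_search_tree G RG (R a) Part Split [::] t &
    (exists2 g, g \in results le t & c = to a g) /\
    (forall g, g \in results le t -> (c <= to a g)%O).

Definition is_canonical_labelling (C : X -> X) : Prop :=
  forall a, (exists2 g, g \in G & C a = to a g) /\
            (forall g, g \in G -> C (to a g) = C a).

End Canonical.

(* Main.v *)
Require Import Defs.
From mathcomp Require Import all_boot all_order all_fingroup.

(** The whole search is equivariant under [G], so the permutations that it
    returns exhaust [G] and [Canonical a] is simply the minimum of the orbit of
    [a] under [G].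

    In detail: [R a] commutes with every permutation by compatibility, [RG]
    commutes with the elements of [G] because a refiner for [G] carries
    [Iso S (S^g)], for [g] in [G], into [Iso (RG S) (RG (S^g))], and [Part],
    [Split] and the approximator commute with every permutation. Hence
    relabelling by [g] in [G] turns a run of Search on [S] into a run on [S^g]
    ([search_path_act]). The empty stack, at the root, is fixed, so [G] permutes
    the leaves of the tree: a leaf with stacks [st] and result [p] goes to a leaf
    with stacks [st^g] and result [g^-1 * p], as [p] minimises a list [l] if and
    only if [g^-1 * p] minimises [l^g]. The order on stacks cannot distinguish
    [st] from [st^g], so minimal leaves go to minimal leaves. Some minimal leaf
    exists, with a result [p] in [G]; its images have the results [g^-1 * p],
    which are all the elements of [G] ([mem_results]).

    The result at a leaf is determined by the stack there: the approximator is
    trivial, so every cell is a singleton, as a cell with two points would leave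
    their transposition in the approximator ([approx_trivial_mem_Fix]); and a
    minimising permutation for a list of all points is unique. Therefore every
    search tree on the empty stack has these leaves ([leaves_search_path]). *)

Set Implicit Arguments.
Unset Strict Implicit.

Section Minima.

Variables (T : eqType) (lt : rel T).
Hypotheses (lt_irr : irreflexive lt) (lt_trans : transitive lt).

Lemma has_minimal (s : seq T) :
  s != [::] -> exists2 m, m \in s & ~~ has (fun l => lt l m) s.
Proof.
elim: s => // x s IHs _; have [->|/IHs[m ms mP]] := eqVneq s [::].
  by exists x; rewrite ?mem_head //= lt_irr.
have [ltxm|nltxm] := boolP (lt x m); last first.
  by exists m; rewrite ?inE ?ms ?orbT //= negb_or nltxm.
exists x; rewrite ?mem_head //= lt_irr; apply: contra mP.
by move=> /hasP[l ls ltlx]; apply/hasP; exists l => //; apply: lt_trans ltxm.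
Qed.

End Minima.

(** * Stacks, ordered partitions and minimising permutations under relabelling *)

Section Relabelling.

Import GroupScope.

Variables (d : Order.disp_t) (Omega : finOrderType d) (L : eqType).

Lemma stack_act1 (T : finType) (S : stack T L) : stack_act S 1 = S.
Proof.
rewrite /stack_act -[RHS]map_id; apply/eq_map => -[f h].
rewrite /ldigraph_act /=; congr pair; apply/ffunP => e; rewrite ffunE invg1.
  by rewrite perm1.
by rewrite !perm1 -surjective_pairing.
Qed.

Lemma stack_act_cat (S T : stack Omega L) g :
  stack_act (S ++ T) g = stack_act S g ++ stack_act T g.
Proof. exact: map_cat. Qed.

(** A refiner for [G] is equivariant under [G], because an element [g] of [G]
    lies in [Iso S (S^g)] and must therefore carry [RG S] to [RG (S^g)]. *)
Lemma refiner_act (G : {group {perm Omega}}) (RG : stack Omega L -> stack Omega L)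
    S g :
  is_refiner_for G RG -> g \in G -> RG (stack_act S g) = stack_act (RG S) g.
Proof.
move=> refG gG.
have gI : g \in Iso S (stack_act S g) by rewrite inE.
have /subsetP/(_ g) : G :&: Iso S (stack_act S g)
                      \subset G :&: Iso (RG S) (RG (stack_act S g)).
  by apply: refG; apply/set0Pn; exists g.
by rewrite !in_setI gG gI inE => /(_ isT) /eqP.
Qed.

Lemma Fix_act (P : seq {set Omega}) (g : {perm Omega}) :
  Fix (opart_act P g) = [seq g x | x <- Fix P].
Proof.
elim: P => //= B P IHP; rewrite /Fix /= card_imset; last exact: perm_inj.
have [/cards1P[x ->]|_] := boolP (#|B| == 1%N); last exact: IHP.
by rewrite /= map_cat imset_set1 !enum_set1 -IHP.
Qed.

Lemma total_actM (aT : finGroupType) (T : Type) (to : {action aT &-> T}) x g h :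
  to x (g * h) = to (to x g) h.
Proof. by case: to => f fP /=; case: fP => _ fM; apply: fM; rewrite inE. Qed.

Section MinPerm.

Variable G : {group {perm Omega}}.

Lemma min_perm_exists l : exists p, is_min_perm G l p.
Proof.
pose F (p : {perm Omega}) : seqlexi Omega := [seq p x | x <- l].
case: (Order.TotalTheory.arg_minP (P := mem G) F (group1 G)) => p pG pP.
by exists p; split.
Qed.

(** [h] acts on [l^g] as [g * h] acts on [l], and [g * h] runs over [G] with
    [h]: the minimal images of [l] and [l^g] coincide. *)
Lemma min_perm_act l p g :
  g \in G -> is_min_perm G l p -> is_min_perm G [seq g x | x <- l] (g^-1 * p).
Proof.
move=> gG [pG pP]; split=> [|h hG]; first by rewrite groupM ?groupV.
have -> : [seq (g^-1 * p) x | x <- [seq g x | x <- l]] = [seq p x | x <- l].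
  by rewrite -map_comp; apply: eq_map => x /=; rewrite permM permK.
have -> : [seq h x | x <- [seq g x | x <- l]] = [seq (g * h) x | x <- l].
  by rewrite -map_comp; apply: eq_map => x /=; rewrite permM.
by apply: pP; rewrite groupM.
Qed.

Lemma min_perm_unique l p q :
  (forall x, x \in l) -> is_min_perm G l p -> is_min_perm G l q -> p = q.
Proof.
move=> lT [pG pP] [qG qP]; apply/permP => x.
have : [seq p x | x <- l] = [seq q x | x <- l].
  apply: (@Order.POrderTheory.le_anti _ (seqlexi Omega)).
  by rewrite pP ?qP.
by move=> /eq_in_map; apply.
Qed.

End MinPerm.

Variable Part : stack Omega L -> seq {set Omega}.
Hypothesis estimatorPart : is_ordered_orbit_estimator Part.

Lemma approx1 S : 1 \in approx Part S S.
Proof. by rewrite inE !eqxx opart_act1 /=. Qed.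

Lemma approx_gt1 S : #|approx Part S S| <> 1%N -> (1 < #|approx Part S S|)%N.
Proof.
have : (0 < #|approx Part S S|)%N by apply/card_gt0P; exists 1; exact: approx1.
by case: #|_| => [|[]].
Qed.

Lemma card_approx_act S g :
  #|approx Part (stack_act S g) (stack_act S g)| = #|approx Part S S|.
Proof.
have [_ [_ _ _ actA]] := approx_compatible estimatorPart.
by rewrite actA cardJg.
Qed.

(** The transposition of two points in one cell preserves every cell of the
    partition, so a trivial approximator forces all cells to be singletons, and
    then [Fix] lists every point. *)
Lemma approx_trivial_mem_Fix S :
  #|approx Part S S| = 1%N -> forall x, x \in Fix (Part S).
Proof.
move=> A1 x; have [partP _ _] := estimatorPart.
have /andP[_ /and3P[/eqP covP /trivIsetP trP _]] := partP S.
have : x \in cover [set B in Part S] by rewrite covP in_setT.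
move=> /bigcupP[B]; rewrite inE => BP xB.
apply/flattenP; exists (enum B); last by rewrite mem_enum.
apply/map_f; rewrite mem_filter BP andbT.
apply/cards1P; exists x; apply/eqP; rewrite eqEsubset sub1set xB andbT.
apply/subsetP => y yB; rewrite inE; apply/eqP.
suff tp1 : tperm x y = 1 by have := tpermL x y; rewrite tp1 perm1.
have tA : tperm x y \in approx Part S S.
  rewrite inE eqxx /=; apply/eqP; rewrite /opart_act -[RHS]map_id.
  apply/eq_in_map => C CP; apply/eqP; rewrite eqEcard card_imset ?leqnn ?andbT;
    last exact: perm_inj.
  apply/subsetP => _ /imsetP[z zC ->].
  have [eBC|neBC] := eqVneq B C; first by subst C; case: tpermP => // ->.
  have disj : [disjoint B & C] by apply: trP; rewrite ?inE.
  case: tpermP => // ze; move: zC; rewrite ze => zC.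
    by have := disjointFr disj xB; rewrite zC.
  by have := disjointFr disj yB; rewrite zC.
have /cards1P[h hE] : #|approx Part S S| == 1%N by rewrite A1.
by move: tA (approx1 S); rewrite hE => /set1P -> /set1P ->.
Qed.

End Relabelling.

(** * The lexicographic order on lists of stacks *)

Section Lexicographic.

Import GroupScope.

Variables (Omega : finType) (L : eqType) (le : rel (stack Omega L)).
Hypothesis orderle : is_compatible_order le.

Lemma lex_le_trans : transitive (lex_le le).
Proof.
have [_ le_tr _ _] := orderle.
elim=> [|y t IH] [|x s] [|z u] //= /andP[xy /implyP yx] /andP[yz /implyP zy].
rewrite (le_tr _ _ _ xy yz) /=; apply/implyP => zx.
by apply: IH; [apply: yx; apply: le_tr zx | apply: zy; apply: le_tr xy].
Qed.

Lemma lex_lt_irr : irreflexive (lex_lt le).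
Proof. by move=> s; rewrite /lex_lt andbN. Qed.

Lemma lex_lt_trans : transitive (lex_lt le).
Proof.
move=> t s u /andP[st nts] /andP[tu nut]; apply/andP; split.
  exact: lex_le_trans tu.
by apply: contra nut => us; apply: lex_le_trans st.
Qed.

Lemma le_actl U V g : le (stack_act U g) V = le U V.
Proof. by have [_ _ _ leE] := orderle; rewrite (leE U V g 1) stack_act1. Qed.

Lemma le_actr U V g : le U (stack_act V g) = le U V.
Proof. by have [_ _ _ leE] := orderle; rewrite (leE U V 1 g) stack_act1. Qed.

Lemma lex_le_actl (s t : seq (stack Omega L)) g :
  lex_le le [seq stack_act U g | U <- s] t = lex_le le s t.
Proof. by elim: s t => [|x s IH] [|y t] //=; rewrite le_actl le_actr IH. Qed.

Lemma lex_le_actr (s t : seq (stack Omega L)) g :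
  lex_le le s [seq stack_act U g | U <- t] = lex_le le s t.
Proof. by elim: s t => [|x s IH] [|y t] //=; rewrite le_actl le_actr IH. Qed.

End Lexicographic.

(** * Leaves of search trees *)

Section Search.

Import GroupScope.

Variables (d : Order.disp_t) (Omega : finOrderType d) (L : eqType).
Variables (G : {group {perm Omega}}).
Variables (RG Ra : stack Omega L -> stack Omega L).
Variables (Part : stack Omega L -> seq {set Omega}).
Variables (Split : stack Omega L -> seq (stack Omega L)).
Hypotheses (compatRa : refiner_compatible Ra) (refinerG : is_refiner_for G RG).
Hypothesis estimatorPart : is_ordered_orbit_estimator Part.
Hypothesis splitterSplit : is_compatible_splitter (approx Part) Split.

Local Notation refines := (refines RG Ra Part).
Local Notation tree := (search_tree Omega L).
Local Notation is_search_tree := (is_search_tree G RG Ra Part Split).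

Lemma refines_fun S S1 S2 : refines S S1 -> refines S S2 -> S1 = S2.
Proof.
move=> r1; elim: r1 S2 => {S S1} [S st|S S1 lp r1 IH] S2 r2.
  by case: r2 => // S3 lp; rewrite lp in st.
by case: r2 => [|S3 _ /IH//]; rewrite lp.
Qed.

(** Refine terminates because each iteration but the last makes the approximator
    smaller. *)
Lemma refines_exists S : exists S', refines S S'.
Proof.
have [n] := ubnP #|approx Part S S|; elim: n S => // n IH S ltn.
have [lp|st] := boolP (#|approx Part (refine_step RG Ra S) (refine_step RG Ra S)|
                       < #|approx Part S S|)%N; last first.
  by exists (refine_step RG Ra S); apply: RefineStop.
have [|S' rS'] := IH (refine_step RG Ra S); first exact: leq_trans lp ltn.
by exists S'; apply: RefineLoop.
Qed.

Lemma refine_step_act S g : g \in G ->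
  refine_step RG Ra (stack_act S g) = stack_act (refine_step RG Ra S) g.
Proof.
move=> gG; rewrite /refine_step !stack_act_cat compatRa -stack_act_cat.
by rewrite (refiner_act _ refinerG).
Qed.

Lemma refines_act S S' g : g \in G ->
  refines S S' -> refines (stack_act S g) (stack_act S' g).
Proof.
move=> gG; elim=> {S S'} [S st|S S' lp _ IH].
  rewrite -refine_step_act //; apply: RefineStop.
  by rewrite refine_step_act // !card_approx_act.
apply: RefineLoop; last by rewrite refine_step_act.
by rewrite refine_step_act // !card_approx_act.
Qed.

(** The branches of the execution of Search on [S], with their stacks and their
    result. Unlike a tree, whose lists of children follow the order in which
    Split presents them, a branch can be relabelled by a mere induction. *)
Inductive search_path : stack Omega L -> seq (stack Omega L) -> {perm Omega} ->
    Prop :=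
| PathLeaf S S' p of
    refines S S' & #|approx Part S' S'| = 1%N & is_min_perm G (Fix (Part S')) p :
    search_path S [:: S] p
| PathNode S S' Si st p of
    refines S S' & #|approx Part S' S'| <> 1%N
    & Si \in Split S' & search_path (S' ++ Si) st p :
    search_path S (S :: st) p.

Lemma search_path_group S st p : search_path S st p -> p \in G.
Proof. by elim=> // ? ? ? _ _ []. Qed.

Lemma search_path_act S st p g : g \in G ->
  search_path S st p ->
  search_path (stack_act S g) [seq stack_act U g | U <- st] (g^-1 * p).
Proof.
have [_ _ actP] := estimatorPart; have [_ splitP] := splitterSplit.
move=> gG; elim=> {S st p} [S S' p r A1 pP|S S' Si st p r A1 Sii _ IH].
  apply: (PathLeaf (refines_act gG r)); first by rewrite card_approx_act.
  by rewrite -actP Fix_act; apply: min_perm_act.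
apply: (PathNode (refines_act gG r)); first by rewrite card_approx_act.
  have [_ _ /(_ g)/perm_mem ->] := splitP S' (approx_gt1 A1).
  exact: map_f Sii.
by rewrite -stack_act_cat.
Qed.

Fixpoint search_tree_nested_ind (P : tree -> Prop)
    (PL : forall U p, P (Leaf U p))
    (PN : forall U ts, (forall i, P (nth (Leaf [::] 1) ts i)) -> P (Node U ts))
    (t : tree) : P t.
Proof.
case: t => [U p|U ts]; [exact: (PL) | apply: (PN)].
elim: ts => [|t ts IHts] [|i] /=; do ?exact: (PL).
  exact: (search_tree_nested_ind P PL PN).
exact: IHts.
Defined.

(** A tree on [S] leaves no freedom but the choice of a minimising permutation at
    each leaf, and that one is unique since the list [Fix] at a leaf contains
    every point. *)
Lemma leaves_search_path S t st p :
  is_search_tree S t -> (st, p) \in leaves t <-> search_path S st p.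
Proof.
elim/search_tree_nested_ind: t S st p => [U q|U ts IH] S st p tP.
  inversion tP as [S0 S' q0 r A1 qP eS|]; subst; split=> /=.
    by rewrite inE => /eqP[-> ->]; apply: PathLeaf qP.
  move=> pathP; inversion pathP as [S0 S1 p0 r' A1' pP|S0 S1 Si st' p0 r' nA1];
    subst; have eS := refines_fun r r'; subst S1 => //.
  rewrite inE; apply/eqP; congr pair; apply: min_perm_unique pP qP.
  exact: approx_trivial_mem_Fix A1.
inversion tP as [|S0 S' ts0 r nA1 tsP]; subst.
have flatP l : l \in flatten [seq leaves t | t <- ts] <->
    exists2 Si, Si \in Split S' & search_path (S' ++ Si) l.1 l.2.
  elim: tsP IH {tP} => [|Si t s ts' tP _ IHs] IH /=; first by split=> // -[].
  have {}IHs := IHs (fun i => IH i.+1); rewrite mem_cat.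
  case: l IHs => lst lp IHs /=; have headP := IH 0%N _ lst lp tP.
  split=> [/orP[/headP|/IHs[Sj sj]]|[Sj]].
  - by exists Si; rewrite ?mem_head.
  - by exists Sj; rewrite ?inE ?sj ?orbT.
  rewrite inE => /predU1P[-> /headP -> //|sj jP].
  by apply/orP; right; apply/IHs; exists Sj.
split=> [/mapP[l /flatP[Si Sii lP] [-> ->]]|pathP]; first exact: PathNode lP.
inversion pathP as [S0 S1 p0 r' A1' pP|S0 S1 Si st' p0 r' _ Sii stP];
  subst; have eS := refines_fun r r'; subst S1 => //.
by apply/mapP; exists (st', p) => //; apply/flatP; exists Si.
Qed.

Lemma search_tree_exists S :
  Acc (fun V U => calls RG Ra Part Split U V) S -> exists t, is_search_tree S t.
Proof.
elim=> {}S _ IH; have [S' r] := refines_exists S.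
have [A1|/eqP A1] := eqVneq #|approx Part S' S'| 1%N.
  have [p pP] := min_perm_exists G (Fix (Part S')).
  by exists (Leaf S p); apply: SearchLeaf pP.
suff [ts tsP] : exists ts,
    List.Forall2 (fun Si t => is_search_tree (S' ++ Si) t) (Split S') ts.
  by exists (Node S ts); apply: SearchNode tsP.
have : {subset Split S' <= Split S'} by [].
elim: {1 3}(Split S') => [_|Si s IHs sub]; first by exists [::].
have [|ts tsP] := IHs.
  by move=> Sj sj; apply: sub; rewrite inE sj orbT.
have [|t tP] := IH (S' ++ Si).
  by exists S'; split=> //; exists Si => //; apply: sub; rewrite mem_head.
by exists (t :: ts); constructor.
Qed.

(** A node that is not a leaf has a child, because clause (i) of a splitter has to
    cover the identity of [Iso S' S']. *)
Lemma search_path_exists S :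
  Acc (fun V U => calls RG Ra Part Split U V) S ->
  exists st p, search_path S st p.
Proof.
elim=> {}S _ IH; have [S' r] := refines_exists S.
have [A1|/eqP A1] := eqVneq #|approx Part S' S'| 1%N.
  have [p pP] := min_perm_exists G (Fix (Part S')).
  by exists [:: S], p; apply: PathLeaf pP.
have [Si Sii] : exists Si, Si \in Split S'.
  have [_ splitP] := splitterSplit; have [IsoE _ _] := splitP S' (approx_gt1 A1).
  have : 1 \in Iso S' S' by rewrite inE stack_act1.
  rewrite IsoE; case: (Split S') => [|Si s]; first by rewrite big_nil inE.
  by exists Si; rewrite mem_head.
have [|st [p stP]] := IH (S' ++ Si); first by exists S'; split=> //; exists Si.
by exists (S :: st), p; apply: PathNode stP.
Qed.

Section Results.

Variable le : rel (stack Omega L).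
Hypotheses (orderle : is_compatible_order le)
           (finiteT : search_finite RG Ra Part Split).

(** One minimal leaf, with result [p], already accounts for all of [G]: the images
    of that leaf under [G] are minimal leaves, with results [g^-1 * p]. *)
Lemma mem_results t : is_search_tree [::] t -> results le t =i G.
Proof.
move=> tP h; have leafP st p := leaves_search_path st p tP.
have resP g : reflect (exists st, (st, g) \in min_leaves le t)
                      (g \in results le t).
  by apply: (iffP mapP) => [[[st p] m ->]|[st m]]; [exists st | exists (st, g)].
apply/resP/idP => [[st]|hG].
  by rewrite mem_filter => /andP[_ /leafP/search_path_group].
have lt_tr : transitive (fun l m : seq (stack Omega L) * {perm Omega} =>
                            lex_lt le l.1 m.1).
  by move=> y x z; apply: lex_lt_trans.
have [|[st p] mt mP] := has_minimal (fun l => lex_lt_irr le l.1) lt_tr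
                                    (s := leaves t).
  have [st [p /leafP]] := search_path_exists finiteT.
  by case: (leaves t).
have {}mt := (leafP _ _).1 mt; have pG := search_path_group mt.
(* Relabelling by this [g] turns the result [p] into [g^-1 * p = h]. *)
pose g := p * h^-1; have gG : g \in G by rewrite groupM ?groupV.
exists [seq stack_act U g | U <- st]; rewrite mem_filter; apply/andP; split.
  apply: contra mP => /hasP[[sl q] lt ltl]; apply/hasP.
  (* A leaf below the image under [g] is moved by [g^-1] to one below [st]. *)
  have {}lt := (leafP _ _).1 lt.
  have gVG : g^-1 \in G by rewrite groupV.
  exists ([seq stack_act U g^-1 | U <- sl], (g^-1)^-1 * q).
    exact/leafP/(search_path_act gVG lt).
  by move: ltl; rewrite /lex_lt /= !(lex_le_actl orderle) !(lex_le_actr orderle).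
apply/leafP; have := search_path_act gG mt.
by rewrite /g invMg invgK -mulgA mulVg mulg1.
Qed.

End Results.

End Search.

Theorem lemma4p4 (d dX : Order.disp_t) (Omega : finOrderType d) (L : eqType)
    (G : {group {perm Omega}})
    (X : orderType dX) (to : {action {perm Omega} &-> X})
    (R : X -> stack Omega L -> stack Omega L)
    (RG : stack Omega L -> stack Omega L)
    (Part : stack Omega L -> seq {set Omega})
    (Split : stack Omega L -> seq (stack Omega L))
    (le : rel (stack Omega L))
    (refinerR : forall a, is_obj_refiner to a (R a))
    (compatR : forall a, refiner_compatible (R a))
    (refinerG : is_refiner_for G RG)
    (estimatorPart : is_ordered_orbit_estimator Part)
    (splitterSplit : is_compatible_splitter (approx Part) Split)
    (orderle : is_compatible_order le)
    (finiteT : forall a, search_finite RG (R a) Part Split) :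
  exists Canonical : X -> X,
    (forall a c, is_Canonical G to R RG Part Split le a c <-> c = Canonical a) /\
    is_canonical_labelling G to Canonical.
Proof.
pose C a := to a [arg min_(g < 1%g | g \in G) to a g]%O.
have CG a : exists2 g, g \in G & C a = to a g.
  by rewrite /C; case: Order.TotalTheory.arg_minP => // g gG _; exists g.
have Cmin a g : g \in G -> (C a <= to a g)%O.
  by rewrite /C; case: Order.TotalTheory.arg_minP => // h _; apply.
have toM := total_actM to.
exists C; split=> a; last first.
  split=> // g gG; apply: Order.POrderTheory.le_anti; apply/andP; split.
    have [h hG ->] := CG a; rewrite -(mulKVg g h) toM.
    by rewrite Cmin ?groupM ?groupV.
  by have [h hG ->] := CG (to a g); rewrite -toM Cmin ?groupM.
have resG t : is_search_tree G RG (R a) Part Split [::] t -> results le t =i G.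
  by apply: mem_results.
move=> c; split=> [[t tP [[g gt ->] tmin]]|->].
  apply: Order.POrderTheory.le_anti; rewrite Cmin ?andbT -?(resG t) //.
  by have [h hG ->] := CG a; apply: tmin; rewrite (resG t).
have [t tP] := search_tree_exists G (finiteT a).
exists t => //; split=> [|g]; last by rewrite (resG t) //; apply: Cmin.
by have [g gG Ca] := CG a; exists g; rewrite ?(resG t).
Qed.
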